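(* Let $\alpha$ be a real number with $2 < \alpha \leq \frac{7}{3}$, and let $x \in \{0,1\}^*$ be a word avoiding $\alpha$-powers. Let $\mu$ be the Thue-Morse morphism. Then there exist words $u, v \in \{\epsilon, 0, 1, 00, 11\}$ and a word $y \in \{0,1\}^*$ avoiding $\alpha$-powers such that $x = u\,\mu(y)\,v$.
   Context: $\epsilon$ denotes the empty word, and $|w|$ the length of a word $w$. The Thue-Morse morphism $\mu:\{0,1\}^*\to\{0,1\}^*$ is the morphism (i.e. $\mu(st)=\mu(s)\mu(t)$ for all words $s,t$) with $\mu(0)=01$, $\mu(1)=10$. A word $v$ is a factor of a word $x$ if $x = uvw$ for some (possibly empty) words $u,w$. For a rational number $\beta \geq 1$, a nonempty word $w$ is a $\beta$-power if there exist a nonempty word $y$, a prefix $y'$ of $y$, and an integer $n \ge 0$ such that $w = y^n y'$ and $n + |y'|/|y| = \beta$. For a real number $\alpha$, a word avoids $\alpha$-powers (is $\alpha$-power-free) if it contains no factor that is a $\beta$-power for any rational $\beta \geq \alpha$. *)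

(* Defs.v *)
From mathcomp Require Import all_boot all_order all_algebra reals.

Set Implicit Arguments.
Unset Strict Implicit.
Unset Printing Implicit Defensive.

Import Order.TTheory GRing.Theory Num.Theory.
Local Open Scope ring_scope.

(* Words over {0,1} are [seq bool], with 0 encoded as [false] and 1 as [true]. *)

Definition thue_morse_letter (a : bool) : seq bool :=
  if a then [:: true; false] else [:: false; true].

Definition thue_morse (w : seq bool) : seq bool :=
  flatten [seq thue_morse_letter a | a <- w].

Lemma thue_morse_cat (s t : seq bool) :
  thue_morse (s ++ t) = thue_morse s ++ thue_morse t.
Proof. by rewrite /thue_morse map_cat flatten_cat. Qed.

(* The decomposition w = y^n y' has exponent n + |y'|/|y|. *)
Definition is_power (T : eqType) (beta : rat) (w : seq T) : Prop :=
  [/\ 1 <= beta, w != [::] &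
    exists (y y' : seq T) (n : nat),
      [/\ y != [::], prefix y' y, w = flatten (nseq n y) ++ y' &
          n%:R + (size y')%:R / (size y)%:R = beta]].

Definition power_free (R : realType) (T : eqType) (alpha : R) (w : seq T)
    : Prop :=
  forall (beta : rat) (f : seq T),
    alpha <= ratr beta -> infix f w -> ~ is_power beta f.

(* Main.v *)
Require Import Defs.
From mathcomp Require Import all_boot all_order all_algebra reals.
From mathcomp Require Import lra.

(** The decomposition is built by reading [x] from right to left, which
    succeeds for every word without a factor [p p q] where [q] is a prefix of [p]
    at least a third as long as [p] ([seven_thirds_free_decomposition]).
    A letter put in front of [u ++ thue_morse y ++ v] either extends the border
    [u] or pairs with it to form a new block [01] or [10].  This can only get
    stuck when the border is already a double letter [aa].  A third [a] would be
    a cube, so the new letter is [b] different from [a], and the first block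
    must be re-cut as [ba] followed by an [a] that shifts all later block
    boundaries by one.  Every way of continuing [baa] by two whole blocks
    creates one of [aaa], [ababa] or [baabaab], of exponents 3, 5/2 and 7/3;
    so [y] has at most one letter and the re-cutting succeeds by inspection.

    Whatever decomposition is obtained, [y] inherits power-freeness from [x]:
    the morphism doubles all lengths, so it maps a power in [y] to a power in
    [x] with the same exponent ([power_free_preimage]). *)

Set Implicit Arguments.
Unset Strict Implicit.
Unset Printing Implicit Defensive.

Import Order.TTheory GRing.Theory Num.Theory.
Local Open Scope ring_scope.

Lemma size_thue_morse (w : seq bool) : size (thue_morse w) = (2 * size w)%N.
Proof. by elim: w => // -[] w IHw; rewrite /= -/(thue_morse w) IHw mulnS. Qed.

Lemma thue_morse_flatten_nseq (n : nat) (w : seq bool) :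
  thue_morse (flatten (nseq n w)) = flatten (nseq n (thue_morse w)).
Proof. by elim: n => //= n IHn; rewrite thue_morse_cat IHn. Qed.

(** All lengths double, so the exponent does not change. *)
Lemma is_power_thue_morse (beta : rat) (w : seq bool) :
  is_power beta w -> is_power beta (thue_morse w).
Proof.
case=> beta_ge1 w_neq0 [p [q [n [p_neq0 /prefixP[r p_eq] w_eq beta_eq]]]].
split=> //; first by rewrite -size_eq0 size_thue_morse muln_eq0 /= size_eq0.
exists (thue_morse p), (thue_morse q), n; split.
- by rewrite -size_eq0 size_thue_morse muln_eq0 /= size_eq0.
- by rewrite p_eq thue_morse_cat prefix_prefix.
- by rewrite w_eq thue_morse_cat thue_morse_flatten_nseq.
by rewrite !size_thue_morse !natrM -mulf_div divff ?mul1r.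
Qed.

Lemma power_free_preimage (R : realType) (alpha : R) (u y v : seq bool) :
  power_free alpha (u ++ thue_morse y ++ v) -> power_free alpha y.
Proof.
move=> x_free beta f beta_ge /infixP[s [t y_eq]] /is_power_thue_morse f_pow.
apply: x_free beta_ge _ f_pow.
apply/infixP; exists (u ++ thue_morse s), (thue_morse t ++ v).
by rewrite y_eq !thue_morse_cat !catA.
Qed.

(** The factor [p p q] has exponent [2 + |q|/|p|], so that the bound 7/3
    becomes an inequality between lengths.  Exponents between 2 and 3 are all
    that the decomposition uses. *)
Definition seven_thirds_free (x : seq bool) : Prop :=
  forall p q : seq bool, p != [::] -> prefix q p ->
    (size p <= 3 * size q)%N -> ~~ infix (p ++ p ++ q) x.

Lemma power_free_seven_thirds (R : realType) (alpha : R) (x : seq bool) :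
  alpha <= 7 / 3 -> power_free alpha x -> seven_thirds_free x.
Proof.
move=> alpha_le x_free p q p_neq0 q_pre le_pq; apply/negP => x_inf.
have p_gt0 : (0 < size p)%N by rewrite lt0n size_eq0.
have third : 1 / 3 <= (size q)%:R / (size p)%:R :> rat.
  rewrite ler_pdivlMr ?ltr0n // mulrAC ler_pdivrMr // mul1r mulrC -natrM.
  by rewrite ler_nat.
apply: (x_free (2%:R + (size q)%:R / (size p)%:R) _ _ x_inf).
  apply: le_trans alpha_le _.
  have -> : 7 / 3 = ratr (2 + 1 / 3 : rat) :> R.
    by rewrite rmorphD /= fmorph_div /= !rmorph_nat rmorph1; lra.
  by rewrite ler_rat lerD2l.
split; first by lra.
  by case: (p) p_neq0.
by exists p, q, 2; split=> //=; rewrite cats0 catA.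
Qed.

Lemma seven_thirds_free_behead (a : bool) (x : seq bool) :
  seven_thirds_free (a :: x) -> seven_thirds_free x.
Proof.
move=> x_free p q p_neq0 q_pre le_pq.
apply: contra (x_free p q p_neq0 q_pre le_pq) => x_inf.
by rewrite infix_consl x_inf orbT.
Qed.

Definition borders : seq (seq bool) :=
  [:: [::]; [:: false]; [:: true]; [:: false; false]; [:: true; true]].

(** The word [baa] followed by whole blocks occurs when [b] is put in front of
    the border [aa].  Cutting from the left again shifts the blocks by one, and
    no left border remains.  In a long word the shift could conflict with the
    old blocks, but three short powers rule out two blocks after [baa]. *)
Lemma recut_decomposition (a : bool) (y v : seq bool) :
  let x := [:: ~~ a, a, a & thue_morse y ++ v] in
  seven_thirds_free x -> v \in borders ->
  exists y' v' : seq bool, v' \in borders /\ x = thue_morse y' ++ v'.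
Proof.
move=> x x_free v_border.
have cube := x_free [:: a] [:: a] isT (prefix_refl _) isT.
have five_halves :=
  x_free [:: a; ~~ a] [:: a] isT (prefix_prefix [:: a] _) isT.
have seven_thirds :=
  x_free [:: ~~ a; a; a] [:: ~~ a] isT (prefix_prefix [:: ~~ a] _) isT.
move: cube five_halves seven_thirds; rewrite {x_free}/x.
(* The first two letters of [y] already force one of the three powers. *)
case: y => [|b [|c y]];
  last by case: a b c => [] [] []; rewrite /= ?prefix0s ?orbT.
- (* [v] cannot begin with [a], so [baa v] is read as [ba] and [a v]. *)
  move: v_border; rewrite !inE => /or4P[|||/orP[]] /eqP->;
    case: a => //= _ _ _.
  + by exists [:: false], [:: true].
  + by exists [:: true], [:: false].
  + by exists [:: false; true], [::].
  + by exists [:: true; false], [::].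
  + by exists [:: false; true], [:: false].
  + by exists [:: true; false], [:: true].
- (* A block [ab] after [baa] makes a cube; [baa ba v] is read as [ba ab] and
     [a v], where [v] may now begin with [a]. *)
  move: v_border; rewrite !inE => /or4P[|||/orP[]] /eqP->;
    case: a b => [] [] //= _ _ _.
  + by exists [:: false; true], [:: true].
  + by exists [:: true; false], [:: false].
  + by exists [:: false; true; true], [::].
  + by exists [:: true; false], [:: false; false].
  + by exists [:: false; true], [:: true; true].
  + by exists [:: true; false; false], [::].
  + by exists [:: false; true; true], [:: false].
  + by exists [:: true; false; false], [:: true].
Qed.

(** When the new letter [a] does not extend the border [u], either [u] is the
    single letter different from [a], which completes a block, or [u] is a
    double letter and the word is cut again from the left. *)
Lemma seven_thirds_free_decomposition (x : seq bool) :
  seven_thirds_free x ->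
  exists u v y : seq bool,
    [/\ u \in borders, v \in borders & x = u ++ thue_morse y ++ v].
Proof.
elim: x => [|a x IHx] x_free; first by exists [::], [::], [::].
have [u [v [y [u_border v_border x_eq]]]] :=
  IHx (seven_thirds_free_behead x_free).
have cube := x_free [:: a] [:: a] isT (prefix_refl _) isT.
case: (boolP (a :: u \in borders)) => [au_border|].
  by exists (a :: u), v, y; rewrite x_eq.
move: u_border x_free cube; rewrite {IHx}x_eq !inE.
case/or4P=> [|||/orP[]] /eqP->; case: a;
  rewrite //= ?prefix0s //= => x_free _ _.
- by exists [::], v, (true :: y).
- by exists [::], v, (false :: y).
- have [y' [v' [v'_border ->]]] :=
    recut_decomposition (a := false) x_free v_border.
  by exists [::], v', y'.
- have [y' [v' [v'_border ->]]] :=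
    recut_decomposition (a := true) x_free v_border.
  by exists [::], v', y'.
Qed.

Theorem theorem6 (R : realType) (alpha : R) (x : seq bool)
  (alpha_gt2 : 2 < alpha) (alpha_le : alpha <= 7 / 3)
  (x_free : power_free alpha x) :
  exists u v y : seq bool,
    [/\ u \in [:: [::]; [:: false]; [:: true]; [:: false; false];
                  [:: true; true]],
        v \in [:: [::]; [:: false]; [:: true]; [:: false; false];
                  [:: true; true]],
        power_free alpha y &
        x = u ++ thue_morse y ++ v].
Proof.
have [u [v [y [u_border v_border x_eq]]]] :=
  seven_thirds_free_decomposition (power_free_seven_thirds alpha_le x_free).
exists u, v, y; split=> //.
by apply: (@power_free_preimage _ _ u y v); rewrite -x_eq.
Qed.
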